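(* Let $X$ and $Y$ be Banach spaces with $1$-unconditional FDDs $(E_n)_{n\in\mathbb{N}}$ and $(F_n)_{n\in\mathbb{N}}$, respectively, where for each $n$ the spaces $E_n$ and $F_n$ have $1$-unconditional normalized bases. Let $l_n=\dim(F_n)$, let $(f_{n,j})_{j=1}^{l_n}$ be the given basis of $F_n$ and $(f^*_{n,j})_{j=1}^{l_n}$ its coordinate functionals. For each $n\in\mathbb{N}$ let $(x_{n,j})_{j=1}^{l_n}$ be vectors in the unit sphere of $E_n$, let $(x^*_{n,j})_{j=1}^{l_n}\subset E_n^*$, and define $T_n\colon E_n\to F_n$ by $T_n(x)=\sum_{j=1}^{l_n}x^*_{n,j}(x)f_{n,j}$. Assume the following. (i) The operator $T\colon X\to Y$, $(x_n)\mapsto(T_n(x_n))$, is well defined and bounded. (ii) $x^*_{n,j}(x_{n,j})\geq 1$ for all $n\in\mathbb{N}$ and $j=1,\dots,l_n$. (iii) $\lim_{m\to\infty}l_m=\infty$ and $\lim_{l\to\infty}\sup_{m\in\mathbb{N},\,l_m\geq l}\frac{\varphi_m(l)}{l}=0$, where $$\varphi_m(l)=\sup\Big\{\Big\|\sum_{i\in A}\sigma_ix_{m,i}\Big\|:\ A\subset\{1,\dots,l_m\},\ |A|\leq l,\ (\sigma_i)_{i\in A}\subset\{\pm1\}\Big\}.$$ (a) For all $\varepsilon>0$ and all infinite $M\subset\mathbb{N}$ there are $\delta>0$ and an infinite $N\subset M$ such that for every $x$ in the closed unit ball of $X_N$, if $\sup_{n\in N,\,1\leq j\leq l_n}|x^*_{n,j}(x)|\leq\delta$,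 then $\|T_N(x)\|<\varepsilon$. (b) For all $\delta,\varepsilon>0$ and all infinite $M\subset\mathbb{N}$ there are $m\in M$ and an infinite $N\subset M$ such that for every $B\in\mathcal{L}(E_m,X_N)$ with $\|B\|\leq1$, $$\Big|\big\{(n,j):\ n\in N,\ 1\leq j\leq l_n,\ |x^*_{n,j}(Bx_{m,i})|>\delta\text{ for some }1\leq i\leq l_m\big\}\Big|<\varepsilon l_m.$$ Then there is a subsequence $(k_n)$ of $\mathbb{N}$ such that, writing $K=\{k_n:n\in\mathbb{N}\}$, $\widetilde X=X_K$, $\widetilde Y=Y_K$, $\widetilde E_n=E_{k_n}$, $\widetilde F_n=F_{k_n}$, $\widetilde T_n=T_{k_n}$, $\tilde l_n=l_{k_n}$, $\tilde x_{n,j}=x_{k_n,j}\in\widetilde E_n$ and $\tilde y^*_{n,j}=f^*_{k_n,j}\in(\widetilde F_n)^*$ for $1\leq j\leq\tilde l_n$, and $\widetilde T_N\colon\widetilde X\to\widetilde Y$ for the operator which maps $(x_n)$ (with $x_n\in\widetilde E_n$) to the element with $n$-component $\widetilde T_n(x_n)$ for $n\in N$ and $0$ for $n\notin N$, the following two conditions hold: (1) $\tilde y^*_{n,j}\big(\widetilde T_n(\tilde x_{n,j})\big)\geq1$ for all $n\in\mathbb{N}$ and $j=1,\dots,\tilde l_n$, where $\|\tilde x_{n,j}\|=\|\tilde y^*_{n,j}\|=1$; (2) $\displaystyle\lim_{m\to\infty,\ m\in M\setminus N}\frac1{\tilde l_m}\sum_{i=1}^{\tilde l_m}\big\|\widetilde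 T_N\circ B(\tilde x_{m,i})\big\|=0$ whenever $M,N$ are infinite subsets of $\mathbb{N}$ such that $M\setminus N$ is infinite, and $B\in\mathcal{L}(\widetilde X)$. Hence, $\mathcal{L}(X,Y)$ contains $2^{\mathfrak{c}}$ closed ideals.
   Context: $\mathfrak{c}$ is the cardinality of the continuum. $\mathcal{L}(V,W)$ is the space of bounded linear operators from $V$ to $W$, and $\mathcal{L}(V)=\mathcal{L}(V,V)$. A closed ideal of $\mathcal{L}(X,Y)$ is a norm-closed linear subspace $\mathcal{J}$ with $ATB\in\mathcal{J}$ for all $A\in\mathcal{L}(Y)$, $T\in\mathcal{J}$, $B\in\mathcal{L}(X)$. An unconditional finite-dimensional decomposition (UFDD) of $X$ is a sequence $(E_n)$ of finite-dimensional subspaces such that each $x\in X$ can be written uniquely as $x=\sum_n x_n$ with $x_n\in E_n$, and the series converges unconditionally; one writes $x=(x_n)$ and calls $x_n$ the $n$-component of $x$. It is a $1$-unconditional FDD if $\|\sum_n\sigma_nx_n\|=\|\sum_nx_n\|$ for all $(x_n)\in X$ and all signs $(\sigma_n)\in\{\pm1\}^{\mathbb{N}}$. For $N\subset\mathbb{N}$, $P^X_N\colon X\to X$ is the projection which replaces by $0$ all $n$-components with $n\notin N$, and $X_N=P^X_N(X)$ is the closed linear span of $\bigcup_{n\in N}E_n$; $P^Y_N$ and $Y_N$ are defined likewise. We put $T_N=T\circ P^X_N=P^Y_N\circ T$. For $x=(x_n)\in X$, $x^*_{n,j}(x)$ means $x^*_{n,j}(x_n)$. *)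

(* Defs.v *)
From mathcomp Require Import all_boot all_order all_algebra.
From mathcomp Require Import all_classical all_reals all_analysis.

Set Implicit Arguments.
Unset Strict Implicit.
Unset Printing Implicit Defensive.

Import Order.TTheory GRing.Theory Num.Theory.
Import numFieldNormedType.Exports.

Local Open Scope classical_set_scope.
Local Open Scope ring_scope.

(* Scalars are real.  Operators between subspaces
   [V] of [X] and [W] of [Y] are represented by total functions [X -> Y]; only
   their values on [V] are constrained and only these are ever used. *)

Definition opnorm (R : realType) (X Y : normedModType R) (V : set X)
    (f : X -> Y) : \bar R :=
  ereal_sup [set (`|f x|)%:E | x in V `&` [set x | `|x| <= 1]].

Definition bounded_op (R : realType) (X Y : normedModType R)
    (V : set X) (W : set Y) : set (X -> Y) :=
  [set f | [/\ forall x, V x -> W (f x),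
               forall (a : R) x y, V x -> V y ->
                 f (a *: x + y) = a *: f x + f y
             & (opnorm V f < +oo)%E]].

Definition closed_ideal (R : realType) (X Y : normedModType R)
    (J : set (X -> Y)) : Prop :=
  [/\ J `<=` bounded_op setT setT,
      J (fun=> 0),
      forall (a : R) S T, J S -> J T -> J (fun x => a *: S x + T x),
      forall A T B, bounded_op (@setT Y) (@setT Y) A -> J T ->
        bounded_op (@setT X) (@setT X) B -> J (A \o T \o B)
    & forall T, bounded_op setT setT T ->
        (forall e : R, 0 < e ->
           exists2 S, J S & (opnorm setT (fun x => (T x - S x)%R) < e%:E)%E) ->
        J T].

Definition lin_span (R : realType) (X : normedModType R) (n : nat)
    (v : 'I_n -> X) : set X :=
  [set x | exists a : 'I_n -> R, x = \sum_(i < n) a i *: v i].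

Definition finite_dim_subspace (R : realType) (X : normedModType R)
    (V : set X) : Prop :=
  exists (n : nat) (v : 'I_n -> X), V = lin_span v.

Definition normalized_1unconditional_basis (R : realType)
    (X : normedModType R) (V : set X) (n : nat) (e : 'I_n -> X) : Prop :=
  [/\ V = lin_span e,
      forall a : 'I_n -> R, \sum_(i < n) a i *: e i = 0 -> forall i, a i = 0,
      forall i, `|e i| = 1
    & forall (a : 'I_n -> R) (s : 'I_n -> bool),
        `|\sum_(i < n) ((-1) ^+ s i * a i) *: e i|
        = `|\sum_(i < n) a i *: e i| ].

(* [j]-th coordinate functional of the basis [e]; relevant on [lin_span e]. *)
Definition coord_functional (R : realType) (X : normedModType R) (n : nat)
    (e : 'I_n -> X) (j : 'I_n) : X -> R^o :=
  fun x => xget (fun=> 0) [set a : 'I_n -> R | x = \sum_(i < n) a i *: e i] j.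

Definition unconditionally_cvg (R : realType) (X : normedModType R)
    (u : nat -> X) : Prop :=
  forall p : nat -> nat, bijective p -> cvgn (series (u \o p)).

Definition fdd_expansion (R : realType) (X : normedModType R)
    (E : nat -> set X) (x : X) : set (nat -> X) :=
  [set u | (forall n, E n (u n)) /\ series u n @[n --> \oo] --> x].

Definition UFDD (R : realType) (X : normedModType R)
    (E : nat -> set X) : Prop :=
  [/\ forall n, finite_dim_subspace (E n),
      forall x, exists! u, fdd_expansion E x u
    & forall x u, fdd_expansion E x u -> unconditionally_cvg u].

(* Convergence of the signed series is automatic for a UFDD. *)
Definition UFDD1 (R : realType) (X : normedModType R)
    (E : nat -> set X) : Prop :=
  UFDD E /\
  forall x u (s : nat -> bool), fdd_expansion E x u ->
    exists2 y : X, series (fun n => (-1) ^+ s n *: u n) n @[n --> \oo] --> y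
                 & `|y| = `|x|.

(* [E] need only be an FDD of a closed subspace: the components are meaningful
   for every [x] of that subspace. *)
Definition fdd_comp (R : realType) (X : normedModType R)
    (E : nat -> set X) (x : X) : nat -> X :=
  xget (fun=> 0) (fdd_expansion E x).

(* The operator mapping [x = (x_n)] to the element with [n]-component
   [S n x_n] for [n] in [N] and [0] for [n] not in [N]. *)
Definition diag_op (R : realType) (X Y : normedModType R)
    (E : nat -> set X) (S : nat -> X -> Y) (N : set nat) (x : X) : Y :=
  limn (series (fun n => if n \in N then S n (fdd_comp E x n) else 0)).

Definition fdd_proj (R : realType) (X : normedModType R)
    (E : nat -> set X) (N : set nat) : X -> X :=
  diag_op E (fun=> id) N.

Definition fdd_sub (R : realType) (X : normedModType R)
    (E : nat -> set X) (N : set nat) : set X :=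
  range (fdd_proj E N).

Definition block_op (R : realType) (X Y : normedModType R) (l : nat -> nat)
    (xs : forall n, 'I_(l n) -> X -> R^o) (f : forall n, 'I_(l n) -> Y)
    (n : nat) (x : X) : Y :=
  \sum_(j < l n) xs n j x *: f n j.

Definition phi (R : realType) (X : normedModType R) (l : nat -> nat)
    (x : forall n, 'I_(l n) -> X) (m k : nat) : R :=
  sup [set r | exists (A : {set 'I_(l m)}) (s : 'I_(l m) -> bool),
         (#|A| <= k)%N /\ r = `|\sum_(i in A) (-1) ^+ s i *: x m i| ].

(* Main.v *)
(** A subsequence [k] is chosen recursively: (a) with [eps = 1/(j+1)] gives
    [delta], condition (iii) gives [L] such that a functional of norm at most
    [|T|] exceeds [delta] at fewer than [L] of the vectors [x m i], and (b) with
    [eps = 1/((j+1) L)] gives the next index [m] and the set of later indices.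
    A contraction from [E m] into the later blocks is then large at few of the
    [x m i], and small after [T] at the others.  The earlier blocks have a total
    dimension fixed before [m] is chosen, so there (iii) alone suffices.

    For the ideals, let [M_r] ([r] real) be an almost disjoint family of infinite
    subsets of [nat].  For a set [S] of reals, the operators [U] such that the
    average of [|U (B x_{m,i})|] tends to 0 along [M_r] for all [B] and all [r]
    outside [S] form a closed ideal, which contains [T_{M_s}] iff [s] is in [S].
    Conversely there are at most [2 ^ c] ideals because an operator is determined
    by countably many real numbers. *)
Require Import Defs.
From mathcomp Require Import all_boot all_order all_algebra finmap.
From mathcomp Require Import all_classical all_reals all_analysis.
From mathcomp Require Import ring lra.

Import Order.TTheory GRing.Theory Num.Theory.
Import numFieldNormedType.Exports.

Local Open Scope classical_set_scope.
Local Open Scope ring_scope.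

(** * Linear subspaces and bounded operators on them *)

Section BoundedOperators.
Local Set Implicit Arguments.
Local Unset Strict Implicit.
Variable R : realType.

Definition linear_subspace (X : normedModType R) (V : set X) :=
  V 0 /\ forall (a : R) x y, V x -> V y -> V (a *: x + y).

Definition linear_on (X Y : normedModType R) (V : set X) (f : X -> Y) :=
  forall (a : R) x y, V x -> V y -> f (a *: x + y) = a *: f x + f y.

Lemma subspaceT (X : normedModType R) : linear_subspace (@setT X).
Proof. by []. Qed.

Lemma subspace_scale (X : normedModType R) (V : set X) a x :
  linear_subspace V -> V x -> V (a *: x).
Proof. by move=> [V0 VL] Vx; rewrite -[_ *: _]addr0; apply: VL. Qed.

Lemma subspace_add (X : normedModType R) (V : set X) x y :
  linear_subspace V -> V x -> V y -> V (x + y).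
Proof. by move=> [V0 VL] Vx Vy; rewrite -[x]scale1r; apply: VL. Qed.

Lemma subspace_sum (X : normedModType R) (V : set X) (I : Type) (r : seq I)
    (P : pred I) (u : I -> X) :
  linear_subspace V -> (forall i, V (u i)) -> V (\sum_(i <- r | P i) u i).
Proof.
by move=> sV Vu; elim/big_ind: _ => //; [case: sV|move=> *; exact: subspace_add].
Qed.

Lemma lin_span_subspace (X : normedModType R) n (e : 'I_n -> X) :
  linear_subspace (lin_span e).
Proof.
split; first by exists (fun=> 0); rewrite big1// => i _; rewrite scale0r.
move=> a _ _ [b ->] [c ->]; exists (fun i => a * b i + c i).
rewrite scaler_sumr -big_split/=; apply: eq_bigr => i _.
by rewrite scalerDl scalerA.
Qed.

Lemma lin_span_mem (X : normedModType R) n (e : 'I_n -> X) i : lin_span e (e i).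
Proof.
exists (fun j => (j == i)%:R); rewrite (bigD1 i)//= eqxx scale1r big1 ?addr0//.
by move=> j /negPf ->; rewrite scale0r.
Qed.

Section LinearOn.
Variables (X Y : normedModType R) (V : set X) (f : X -> Y).
Hypotheses (sV : linear_subspace V) (lf : linear_on V f).

Lemma linear_on0 : f 0 = 0.
Proof.
case: sV => V0 _; have := lf 1 V0 V0; rewrite !scale1r addr0.
by rewrite -[LHS]addr0 => /addrI/esym.
Qed.

Lemma linear_onZ a x : V x -> f (a *: x) = a *: f x.
Proof.
by move=> Vx; have := lf a Vx sV.1; rewrite !addr0 linear_on0 addr0.
Qed.

Lemma linear_onD x y : V x -> V y -> f (x + y) = f x + f y.
Proof. by move=> Vx Vy; have := lf 1 Vx Vy; rewrite !scale1r. Qed.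

Lemma linear_onB x y : V x -> V y -> f (x - y) = f x - f y.
Proof.
move=> Vx Vy; rewrite linear_onD//; last first.
  by rewrite -scaleN1r; exact: subspace_scale.
by rewrite -scaleN1r linear_onZ// scaleN1r.
Qed.

Lemma linear_on_sum (I : Type) (r : seq I) (u : I -> X) :
  (forall i, V (u i)) -> f (\sum_(i <- r) u i) = \sum_(i <- r) f (u i).
Proof.
move=> Vu; elim: r => [|i r IH]; first by rewrite !big_nil linear_on0.
by rewrite !big_cons linear_onD ?IH//; exact: subspace_sum.
Qed.

End LinearOn.

Lemma opnorm_le (X Y : normedModType R) (V : set X) (f : X -> Y) (C : R) :
  0 <= C -> (forall x, V x -> `|f x| <= C * `|x|) -> (opnorm V f <= C%:E)%E.
Proof.
move=> C0 fC; apply: ge_ereal_sup => _ [x [Vx /= x1] <-]; rewrite lee_fin.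
by rewrite (le_trans (fC _ Vx))// ler_piMr.
Qed.

Lemma opnorm_bound (X Y : normedModType R) (V : set X) (f : X -> Y) (C : R) :
  linear_subspace V -> linear_on V f -> (opnorm V f <= C%:E)%E ->
  forall x, V x -> `|f x| <= C * `|x|.
Proof.
move=> sV lf fC x Vx; have [->|x0] := eqVneq x 0.
  by rewrite (linear_on0 sV lf) !normr0 mulr0.
have nx : 0 < `|x| by rewrite normr_gt0.
have : `|f (`|x|^-1 *: x)| <= C.
  rewrite -lee_fin; apply: le_trans fC; apply: ereal_sup_ubound.
  exists (`|x|^-1 *: x) => //; split; first exact: subspace_scale.
  by rewrite /= normrZ normfV normr_id mulVf ?gt_eqF.
rewrite (linear_onZ sV lf)// normrZ normfV normr_id.
by rewrite ler_pdivrMl// mulrC.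
Qed.

(** Trades the finiteness of an extended-real norm for an explicit constant, positive so that later
    estimates may divide by it. *)
Lemma bounded_opP (X Y : normedModType R) (V : set X) (W : set Y) f :
  linear_subspace V -> bounded_op V W f <->
  [/\ forall x, V x -> W (f x), linear_on V f &
      exists2 C : R, 0 < C & forall x, V x -> `|f x| <= C * `|x|].
Proof.
move=> sV; split=> -[fW lf fb]; split => //.
  have n0 : (0 <= opnorm V f)%E.
    apply: ereal_sup_ubound; exists 0; first by
      split; [exact: sV.1|rewrite /= normr0].
    by rewrite (linear_on0 sV lf) normr0.
  have fin : opnorm V f \is a fin_num by rewrite ge0_fin_numE.
  (* The added 1 keeps the constant positive when the operator vanishes on [V]. *)
  exists (fine (opnorm V f) + 1); first by rewrite ltr_wpDl// fine_ge0.
  apply: opnorm_bound => //; rewrite EFinD fineK//.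
  by rewrite leeDl// lee_fin.
case: fb => C C0 fC; rewrite (le_lt_trans _ (ltry C))//.
by apply: opnorm_le => //; exact: ltW.
Qed.

Lemma bounded_opTP (X Y : normedModType R) (f : X -> Y) :
  bounded_op setT setT f <->
  linear_on setT f /\ exists2 C : R, 0 < C & forall x, `|f x| <= C * `|x|.
Proof.
apply: iff_trans (bounded_opP _ _ (@subspaceT X)) _.
by split=> [[_ lf [C C0 fC]]|[lf [C C0 fC]]]; split=> //;
  exists C => // x; exact: fC.
Qed.

End BoundedOperators.

Lemma increasing_inj {k : nat -> nat} :
  {homo k : m n / (m < n)%N} -> injective k.
Proof.
by move=> kh a b kab; case: (ltngtP a b) => // /kh; rewrite kab ltnn.
Qed.

Lemma cvg_increasing_subseq {T : topologicalType} {k : nat -> nat}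
    {u : nat -> T} {z : T} :
  {homo k : m n / (m < n)%N} -> u n @[n --> \oo] --> z ->
  (u \o k) n @[n --> \oo] --> z.
Proof.
move=> kh uz; have kge m : (m <= k m)%N.
  by elim: m => // m /leq_ltn_trans; apply; exact: kh.
apply: cvg_comp uz => P [m _ mP]; exists m => //= i mi.
by apply: mP => /=; exact: leq_trans mi (kge i).
Qed.

(** * Components and projections of a 1-unconditional FDD *)

Section BlockDecomposition.
Local Set Implicit Arguments.
Local Unset Strict Implicit.
Variables (R : realType) (X : normedModType R) (E : nat -> set X).
Hypothesis hE : UFDD1 E.

Lemma fdd_subspace n : linear_subspace (E n).
Proof. by have [[/(_ n) [d [e ->]] _ _] _] := hE; exact: lin_span_subspace. Qed.

Lemma fdd_compP x : fdd_expansion E x (fdd_comp E x).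
Proof.
rewrite /fdd_comp; have [[_ /(_ x) [u [eu _]] _] _] := hE.
by case: xgetP => // /(_ u).
Qed.

Lemma fdd_comp_uniq x u : fdd_expansion E x u -> fdd_comp E x = u.
Proof.
have [[_ /(_ x) [v [_ vu]] _] _] := hE.
by move=> xu; rewrite -(vu _ xu) (vu _ (fdd_compP x)).
Qed.

Lemma fdd_comp_mem x n : E n (fdd_comp E x n).
Proof. exact: (fdd_compP x).1. Qed.

Lemma fdd_cvg x : series (fdd_comp E x) n @[n --> \oo] --> x.
Proof. exact: (fdd_compP x).2. Qed.

Lemma fdd_comp_linear n : linear_on setT (fun x => fdd_comp E x n).
Proof.
move=> a x y _ _; rewrite (@fdd_comp_uniq _ (a *: fdd_comp E x + fdd_comp E y))//.
split; first by move=> m; apply: (fdd_subspace m).2; exact: fdd_comp_mem.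
rewrite seriesD seriesZ.
by apply: cvgD; [apply: cvgZr; exact: fdd_cvg|exact: fdd_cvg].
Qed.

Lemma fdd_ext x y : (forall n, fdd_comp E x n = fdd_comp E y n) -> x = y.
Proof.
move=> /funext xy; apply: (cvg_unique _ (@fdd_cvg x)).
   exact: norm_hausdorff.
by rewrite xy; exact: fdd_cvg.
Qed.

Lemma series_single (e : X) n :
  series (fun m => if m == n then e else 0) m @[m --> \oo] --> e.
Proof.
apply: cvg_near_cst; exists n.+1 => //= m nm.
rewrite /series/= (bigD1_seq n)/= ?iota_uniq ?mem_index_iota// eqxx.
by rewrite big1 ?addr0// => i /negPf ->.
Qed.

Lemma fdd_comp_block n e m : E n e -> fdd_comp E e m = if m == n then e else 0.
Proof.
move=> En; rewrite (@fdd_comp_uniq _ (fun m => if m == n then e else 0))//.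
split; last exact: series_single.
by move=> i; case: eqP => [->//|_]; exact: (fdd_subspace i).1.
Qed.

(** The projection is the average of the identity and of the sign change that is [-1] off [N]. The
    sign change preserves the norm, so the average does not increase it. *)
Lemma fdd_proj_spec (N : set nat) x :
  series (fun n => if n \in N then fdd_comp E x n else 0) n @[n --> \oo]
    --> fdd_proj E N x /\ `|fdd_proj E N x| <= `|x|.
Proof.
have [y yc yx] := hE.2 x _ (fun n => n \notin N) (fdd_compP x).
have half : series (fun n => if n \in N then fdd_comp E x n else 0) n
    @[n --> \oo] --> 2^-1 *: (x + y).
  have -> : (fun n => if n \in N then fdd_comp E x n else 0) =
      2^-1 *: (fdd_comp E x + (fun n => (-1) ^+ (n \notin N) *: fdd_comp E x n)).
    apply/funext => n; set c := fdd_comp E x.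
    change ((if n \in N then c n else 0) =
      2^-1 *: (c n + (-1) ^+ (n \notin N) *: c n)).
    case: (n \in N); rewrite /= ?expr0 ?expr1 ?scale1r.
      by rewrite -[c n in X in _ *: X]scale1r -scalerDl scalerA mulVf ?scale1r.
    by rewrite scaleN1r subrr scaler0.
  by rewrite seriesZ seriesD; apply: cvgZr; apply: cvgD => //; exact: fdd_cvg.
have -> : fdd_proj E N x = 2^-1 *: (x + y).
  by apply: cvg_lim half; exact: norm_hausdorff.
split => //; rewrite normrZ ger0_norm ?invr_ge0// ler_pdivrMl//.
by rewrite (le_trans (ler_normD _ _))// yx mulr_natl mulr2n.
Qed.

Lemma fdd_proj_cvg N x :
  series (fun n => if n \in N then fdd_comp E x n else 0) n @[n --> \oo]
    --> fdd_proj E N x.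
Proof. exact: (fdd_proj_spec N x).1. Qed.

Lemma fdd_proj_le N x : `|fdd_proj E N x| <= `|x|.
Proof. exact: (fdd_proj_spec N x).2. Qed.

Lemma fdd_proj_comp N x n :
  fdd_comp E (fdd_proj E N x) n = if n \in N then fdd_comp E x n else 0.
Proof.
rewrite (@fdd_comp_uniq _ (fun n => if n \in N then fdd_comp E x n else 0))//.
split; last exact: fdd_proj_cvg.
by move=> i; case: ifP => _; [exact: fdd_comp_mem|exact: (fdd_subspace i).1].
Qed.

Lemma fdd_comp0 n : fdd_comp E 0 n = 0.
Proof. exact: (linear_on0 (@subspaceT _ _) (@fdd_comp_linear n)). Qed.

Lemma fdd_proj_linear N : linear_on setT (fdd_proj E N).
Proof.
move=> a x y _ _; apply: fdd_ext => n.
rewrite fdd_proj_comp !fdd_comp_linear// !fdd_proj_comp.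
by case: ifP => _//; rewrite scaler0 addr0.
Qed.

Lemma fdd_comp_le x n : `|fdd_comp E x n| <= `|x|.
Proof.
have -> : fdd_comp E x n = fdd_proj E [set n] x; last exact: fdd_proj_le.
apply: fdd_ext => m; rewrite fdd_proj_comp.
rewrite (@fdd_comp_block n); last exact: fdd_comp_mem.
by have [->|/eqP mn] := eqVneq m n; [rewrite mem_set|rewrite memNset].
Qed.

Lemma fdd_subP N x : fdd_sub E N x <-> forall n, ~ N n -> fdd_comp E x n = 0.
Proof.
split=> [[y _ <-] n Nn|xN].
  by rewrite fdd_proj_comp memNset.
exists x => //; apply: fdd_ext => n; rewrite fdd_proj_comp.
by case: ifPn => // /negP nN; rewrite xN// => /mem_set.
Qed.

Lemma fdd_proj_id N x : fdd_sub E N x -> fdd_proj E N x = x.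
Proof.
move=> /fdd_subP xN; apply: fdd_ext => n; rewrite fdd_proj_comp.
by case: ifPn => // /negP nN; rewrite xN// => /mem_set.
Qed.

Lemma fdd_proj_sub N x : fdd_sub E N (fdd_proj E N x).
Proof. by exists x. Qed.

Lemma fdd_sub_block (N : set nat) n e : N n -> E n e -> fdd_sub E N e.
Proof.
move=> Nn En; apply/fdd_subP => m Nm; rewrite (fdd_comp_block _ En) ifF//.
by apply/eqP => mn; apply: Nm; rewrite mn.
Qed.

Lemma fdd_sub_subspace N : linear_subspace (fdd_sub E N).
Proof.
split; first by apply/fdd_subP => n _; exact: fdd_comp0.
move=> a x y /fdd_subP xN /fdd_subP yN; apply/fdd_subP => n nN.
by rewrite fdd_comp_linear// xN// yN// scaler0 addr0.
Qed.

Lemma fdd_sub_mono M N : M `<=` N -> fdd_sub E M `<=` fdd_sub E N.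
Proof.
by move=> MN z /fdd_subP zM; apply/fdd_subP => n nN; apply: zM => /MN.
Qed.

Lemma fdd_comp_continuous n (u : nat -> X) z :
  u i @[i --> \oo] --> z -> fdd_comp E (u i) n @[i --> \oo] --> fdd_comp E z n.
Proof.
move=> uz; apply/cvgrPdist_le => e e0; near=> i.
rewrite -(linear_onB (@subspaceT _ _) (@fdd_comp_linear n))//.
apply: le_trans (fdd_comp_le _ _) _.
by near: i; move/cvgrPdist_le: uz; apply.
Unshelve. all: by end_near. Qed.

(** Components are continuous, and the [k i]-component of a partial sum is [u i] once the term [i]
    is included; injectivity of [k] keeps the other terms out of that block. *)
Lemma fdd_comp_series (k : nat -> nat) (u : nat -> X) z i :
  injective k -> (forall n, E (k n) (u n)) ->
  series u n @[n --> \oo] --> z -> fdd_comp E z (k i) = u i.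
Proof.
move=> kinj uE uz; have uzi := fdd_comp_continuous (n := k i) uz.
apply: (cvg_unique _ uzi); first exact: norm_hausdorff.
apply: cvg_near_cst; exists i.+1 => //= m im.
rewrite /series/= (linear_on_sum (@subspaceT _ _) (@fdd_comp_linear (k i)))//.
rewrite (bigD1_seq i)/= ?iota_uniq ?mem_index_iota//.
rewrite (fdd_comp_block _ (uE i)) eqxx big1 ?addr0// => j ji.
rewrite (fdd_comp_block _ (uE j)) ifF//; apply/negbTE; apply: contra ji.
by move=> /eqP/kinj ->.
Qed.

(** Passing from [k n] to [k n.+1] adds the term at [k n] and a gap that misses the range of [k],
    where [v] vanishes. *)
Lemma big_subseq (k : nat -> nat) (v : nat -> X) n :
  {homo k : m n / (m < n)%N} -> (forall m, ~ range k m -> v m = 0) ->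
  \sum_(0 <= i < k n) v i = \sum_(0 <= i < n) v (k i).
Proof.
move=> khomo v0; elim: n => [|n IH].
  rewrite [RHS]big_geq// big_nat big1// => m /= mk; apply: v0 => -[i _ im].
  have : (k 0 <= k i)%N by case: i {im} => // i; exact/ltnW/khomo.
  by rewrite im leqNgt mk.
rewrite big_nat_recr//= -IH (@big_cat_nat _ _ _ (k n))//=; last first.
  by apply/ltnW/khomo.
congr (_ + _); rewrite big_ltn; last exact: khomo.
rewrite big_nat big1 ?addr0// => m /andP[nm mn].
apply: v0 => -[i _ im]; move: nm mn; rewrite -im.
have kle a b : (a <= b)%N -> (k a <= k b)%N.
  by rewrite leq_eqVlt => /predU1P[->//|/khomo/ltnW].
case: (leqP i n) => [/kle|/kle]; first by rewrite leqNgt => /negbTE ->.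
by move=> h _; rewrite ltnNge h.
Qed.

(** [E \o k] need only decompose the subspace of [range k], so [hE] does not apply to it directly.
    Dropping the zero components of [z] gives one expansion, and [fdd_comp_series] shows that [xget]
    can select no other. *)
Lemma fdd_expansion_subseq (k : nat -> nat) z :
  {homo k : m n / (m < n)%N} -> fdd_sub E (range k) z ->
  forall n, fdd_comp (E \o k) z n = fdd_comp E z (k n).
Proof.
move=> khomo zk n.
have kinj := increasing_inj khomo.
have H : fdd_expansion (E \o k) z (fun n => fdd_comp E z (k n)).
  split; first by move=> m; exact: fdd_comp_mem.
  have -> : series (fun n => fdd_comp E z (k n)) = series (fdd_comp E z) \o k.
    apply/funext => m /=; rewrite /series/=.
    rewrite (@big_subseq k (fdd_comp E z))// => i ik.
    by move/fdd_subP : zk; exact.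
  exact: cvg_increasing_subseq (@fdd_cvg z).
rewrite {1}/fdd_comp; case: xgetP => [u _ [uE uz]|/(_ _ H)//].
by rewrite (fdd_comp_series n kinj uE uz).
Qed.

End BlockDecomposition.

(** * Coordinates in a normalized 1-unconditional basis *)

Section UnconditionalBasis.
Local Set Implicit Arguments.
Local Unset Strict Implicit.
Variables (R : realType) (X : normedModType R) (V : set X) (n : nat).
Variable e : 'I_n -> X.
Hypothesis he : normalized_1unconditional_basis V e.

(** Flipping every sign except the [j]-th preserves the norm, and the flipped vector plus the
    original one is [2 * a j] times [e j]. *)
Lemma basis_coord_le (a : 'I_n -> R) j : `|a j| <= `|\sum_(i < n) a i *: e i|.
Proof.
have [_ _ e1 eunc] := he.
have := eunc a (fun i => i != j); set v := \sum_(i < n) a i *: e i.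
set w := \sum_(i < n) _ => wv.
have vw : v + w = (2 * a j) *: e j.
  rewrite -big_split/= (bigD1 j)//= eqxx expr0 mul1r -scalerDl big1 ?addr0.
    by congr (_ *: _); lra.
  by move=> i -> ; rewrite expr1 -scalerDl mulN1r subrr scale0r.
have : `|v + w| <= `|v| + `|w| by exact: ler_normD.
rewrite vw wv normrZ e1 mulr1 normrM ger0_norm//; lra.
Qed.

Lemma coord_functionalE (a : 'I_n -> R) j :
  coord_functional e j (\sum_(i < n) a i *: e i) = a j.
Proof.
have [_ eind _ _] := he.
rewrite /coord_functional; case: xgetP => [b _ /= ab|/(_ a)[]//].
apply/esym/eqP; rewrite -subr_eq0; apply/eqP.
apply: (eind (fun i => a i - b i)).
under eq_bigr do rewrite scalerBl.
by rewrite sumrB ab subrr.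
Qed.

Lemma coord_functional_opnorm j : opnorm V (coord_functional e j) = 1%:E.
Proof.
have [-> _ e1 _] := he.
have cj : coord_functional e j (e j) = 1.
  have ej : e j = \sum_(i < n) (i == j)%:R *: e i.
    rewrite (bigD1 j)//= eqxx scale1r big1 ?addr0// => i /negPf ->.
    by rewrite scale0r.
  by rewrite {1}ej coord_functionalE eqxx.
apply/eqP; rewrite eq_le; apply/andP; split.
  apply: opnorm_le => // _ [a ->].
  by rewrite coord_functionalE mul1r; exact: basis_coord_le.
apply: ereal_sup_ubound; exists (e j); last by rewrite cj normr1.
by split; [exact: lin_span_mem|rewrite /= e1].
Qed.

End UnconditionalBasis.

(** * The function [phi] and sums of a functional over the vectors [x m i] *)

Section SpreadVectors.
Variables (R : realType) (X : normedModType R) (E : nat -> set X).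
Hypothesis hE : UFDD1 E.
Variables (l : nat -> nat) (x : forall n, 'I_(l n) -> X).
Hypothesis hx : forall n j, E n (@x n j) /\ `|@x n j| = 1.

Local Set Implicit Arguments.
Local Unset Strict Implicit.

Let signed_sum_le m k (A : {set 'I_(l m)}) (s : 'I_(l m) -> bool) :
  (#|A| <= k)%N -> `|\sum_(i in A) (-1) ^+ s i *: x m i| <= k%:R.
Proof.
move=> Ak; apply: le_trans (ler_norm_sum _ _ _) _.
rewrite (eq_bigr (fun=> 1)); last first.
  by move=> i _; rewrite normrZ normrX normrN1 expr1n mul1r (hx _ _).2.
by rewrite sumr_const ler_nat.
Qed.

(** The signed sums have norm at most [k] because the vectors are normalized; this boundedness is
    what makes the real [sup] in [phi] an upper bound. *)
Lemma phi_ubound m k (A : {set 'I_(l m)}) (s : 'I_(l m) -> bool) :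
  (#|A| <= k)%N -> `|\sum_(i in A) (-1) ^+ s i *: x m i| <= phi x m k.
Proof.
move=> Ak; apply: ub_le_sup; last by exists A, s.
by exists k%:R => _ [B [t [Bk ->]]]; exact: signed_sum_le.
Qed.

Lemma phi_le m k : phi x m k <= k%:R.
Proof.
apply: ge_sup.
  exists `|\sum_(i in finset.set0) (-1) ^+ false *: x m i|.
  by exists finset.set0, (fun=> false); rewrite cards0.
by move=> _ [B [t [Bk ->]]]; exact: signed_sum_le.
Qed.

Lemma phi_ge0 m k : 0 <= phi x m k.
Proof.
by apply: le_trans (phi_ubound (A := finset.set0) (fun=> false) _);
  rewrite ?cards0.
Qed.

(** All the ratios are at most 1, so the real supremum in (iii) dominates each of them. At [k = 0]
    the ratio is 0, by the convention for the inverse of 0. *)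
Lemma phi_ratio_le m k : (k <= l m)%N ->
  phi x m k / k%:R <= sup [set phi x m k / k%:R | m in [set m | (k <= l m)%N]].
Proof.
move=> km; apply: ub_le_sup; last by exists m.
exists 1 => _ [n _ <-]; case: k {km} => [|k]; first by rewrite invr0 mulr0.
by rewrite ler_pdivrMr ?ltr0Sn// mul1r; exact: phi_le.
Qed.

(** Signs matching those of [g (x m i)] turn the sum of absolute values into the value of [g] at a
    single signed sum, whose norm [phi] controls. *)
Lemma sum_functional_le m (A : {set 'I_(l m)}) (g : X -> R^o) (K : R) :
  0 <= K -> linear_on (E m) g -> (forall e, E m e -> `|g e| <= K * `|e|) ->
  \sum_(i in A) `|g (x m i)| <= K * phi x m #|A|.
Proof.
move=> K0 lg gK; pose s i := g (x m i) < 0.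
have sE := fdd_subspace hE m.
have Ex i : E m ((-1) ^+ s i *: x m i).
  by apply: subspace_scale => //; exact: (hx _ _).1.
have -> : \sum_(i in A) `|g (x m i)| = g (\sum_(i in A) (-1) ^+ s i *: x m i).
  rewrite -[in RHS]big_enum/= (linear_on_sum sE lg)// big_enum/=.
  apply: eq_bigr => i _.
  rewrite (linear_onZ sE lg); last exact: (hx _ _).1.
  rewrite /s; case: ltP => g0; first by rewrite ltr0_norm// expr1 scaleN1r.
  by rewrite ger0_norm// expr0 scale1r.
apply: le_trans (ler_norm _) _; apply: le_trans (gK _ _) _.
  exact: subspace_sum.
by apply: ler_wpM2l => //; exact: phi_ubound.
Qed.

End SpreadVectors.

Lemma card_big_setU_le (I : Type) (T : finType) (r : seq I) (A : I -> {set T}) k :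
  (forall i, #|A i| <= k)%N ->
  (#|\big[@finset.setU T/finset.set0]_(i <- r) A i| <= size r * k)%N.
Proof.
move=> Ak; elim: r => [|i r IH]; first by rewrite big_nil cards0.
by rewrite big_cons mulSn (leq_trans (leq_card_setU _ _).1)// leq_add.
Qed.

Lemma infinite_set_tail (N : set nat) k :
  infinite_set N -> infinite_set (N `&` [set n | (k <= n)%N]).
Proof.
move=> Ninf fin; apply: Ninf.
apply: (@sub_finite_set _ N ((N `&` [set n | (k <= n)%N]) `|` `I_k)).
  by move=> n Nn; have [kn|nk] := leqP k n; [left|right].
by rewrite finite_setU; split => //; exact: finite_II.
Qed.

(** * The operator [T] on single blocks *)

Section DiagonalOperator.
Variables (R : realType) (X Y : normedModType R).
Variables (E : nat -> set X) (F : nat -> set Y).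
Hypotheses (hE : UFDD1 E) (hF : UFDD1 F).
Variables (l : nat -> nat) (f : forall n, 'I_(l n) -> Y).
Hypothesis hFbasis : forall n, normalized_1unconditional_basis (F n) (@f n).
Variable xs : forall n, 'I_(l n) -> X -> R^o.
Hypothesis hxs : forall n j, bounded_op (E n) setT (@xs n j).
Variable T : X -> Y.
Hypothesis hT :
  forall z n, fdd_comp F (T z) n = block_op xs f n (fdd_comp E z n).

Local Set Implicit Arguments.
Local Unset Strict Implicit.

Lemma functional_linear n j : linear_on (E n) (@xs n j).
Proof. by have [_ lxs _] := hxs n j; exact: lxs. Qed.

Lemma block_op_mem n e : F n (block_op xs f n e).
Proof.
by have [-> _ _ _] := hFbasis n; exists (fun j => xs n j e).
Qed.

Lemma functional0 n j : @xs n j 0 = 0.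
Proof. exact: (linear_on0 (fdd_subspace hE n) (@functional_linear n j)). Qed.

Lemma block_op0 n : block_op xs f n 0 = 0.
Proof. by rewrite /block_op big1// => j _; rewrite functional0 scale0r. Qed.

Lemma diagonal_block n e : E n e -> T e = block_op xs f n e.
Proof.
move=> En; apply: (fdd_ext hF) => m.
rewrite hT (fdd_comp_block hE m En) (fdd_comp_block hF m (block_op_mem n e)).
by case: eqP => [->//|_]; exact: block_op0.
Qed.

Lemma coord_block_op n e j :
  coord_functional (@f n) j (block_op xs f n e) = @xs n j e.
Proof. exact: coord_functionalE (hFbasis n) _ _. Qed.

Variable D : R.
Hypothesis hTD : forall z, `|T z| <= D * `|z|.

(** [xs n j e] is the [j]-th coordinate of [T e], and a coordinate never exceeds the norm of the
    vector. *)
Lemma functional_le n j e : E n e -> `|@xs n j e| <= D * `|e|.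
Proof.
move=> En; apply: le_trans (hTD e); rewrite (diagonal_block En).
exact: (basis_coord_le (hFbasis n) (fun j => xs n j e)).
Qed.

End DiagonalOperator.

(** * Choice of the subsequence and the estimate of the averages *)

Section Subsequence.
Variables (R : realType) (X Y : normedModType R).
Variables (E : nat -> set X) (F : nat -> set Y).
Hypotheses (hE : UFDD1 E) (hF : UFDD1 F).
Variables (l : nat -> nat) (f : forall n, 'I_(l n) -> Y).
Hypothesis hFbasis : forall n, normalized_1unconditional_basis (F n) (@f n).
Variable x : forall n, 'I_(l n) -> X.
Hypothesis hx : forall n j, E n (@x n j) /\ `|@x n j| = 1.
Variable xs : forall n, 'I_(l n) -> X -> R^o.
Hypothesis hxs : forall n j, bounded_op (E n) setT (@xs n j).
Variable T : X -> Y.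
Hypothesis hT :
  forall z n, fdd_comp F (T z) n = block_op xs f n (fdd_comp E z n).
Hypothesis hTlin : linear_on setT T.
Hypothesis hl : l m @[m --> \oo] --> \oo.
Hypothesis hphi : sup [set phi x m k / k%:R | m in [set m | (k <= l m)%N]]
            @[k --> \oo] --> (0 : R).
Hypothesis ha : forall (eps : R) (M : set nat), 0 < eps -> infinite_set M ->
     exists (delta : R) (N : set nat),
       [/\ 0 < delta, infinite_set N, N `<=` M
         & forall z, fdd_sub E N z -> `|z| <= 1 ->
           (ereal_sup [set r | exists (n : nat) (j : 'I_(l n)),
                         N n /\ r = (`|@xs n j (fdd_comp E z n)|)%:E]
              <= delta%:E)%E ->
           `|T (fdd_proj E N z)| < eps].
Hypothesis hb : forall (delta eps : R) (M : set nat),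
     0 < delta -> 0 < eps -> infinite_set M ->
     exists (m : nat) (N : set nat),
       [/\ M m, infinite_set N, N `<=` M
         & forall B : X -> X,
           bounded_op (E m) (fdd_sub E N) B -> (opnorm (E m) B <= 1%:E)%E ->
           let S := [set p : {n : nat & 'I_(l n)} | N (tag p) /\
             exists i : 'I_(l m),
               delta < `|@xs (tag p) (tagged p) (fdd_comp E (B (@x m i)) (tag p))| ]
           in
           finite_set S /\ (#|` fset_set S|)%:R < eps * (l m)%:R].

Local Set Implicit Arguments.
Local Unset Strict Implicit.

Variable D : R.
Hypotheses (D0 : 0 < D) (hTD : forall z, `|T z| <= D * `|z|).

(** Removes the supremum from (iii): one [L] serves all [m]. Its positivity permits division by [k]
    and, later, by [L]. *)
Lemma phi_ratio_small (e : R) : 0 < e -> exists2 L, (0 < L)%N &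
  forall m k, (L <= k)%N -> (k <= l m)%N -> phi x m k <= e * k%:R.
Proof.
move=> e0; move/cvgrPdist_le : hphi => /(_ e e0) [L _ Lh].
exists L.+1 => // m k Lk km.
have k0 : (0 < k)%N by exact: leq_ltn_trans Lk.
have := Lh k (ltnW Lk); rewrite /= sub0r normrN => /(le_trans (ler_norm _)) h.
rewrite -ler_pdivrMr ?ltr0n//; apply: le_trans h; exact: (phi_ratio_le hx).
Qed.

Lemma functional_comp_linear (B : X -> X) m n (s : 'I_(l n)) :
  linear_on (E m) B -> linear_on (E m) (fun e => xs n s (fdd_comp E (B e) n)).
Proof.
move=> lB a u v Eu Ev; rewrite lB// (fdd_comp_linear hE)//.
by apply: (functional_linear hxs); exact: fdd_comp_mem.
Qed.

Lemma functional_comp_le (B : X -> X) m n (s : 'I_(l n)) (C : R) :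
  (forall e, E m e -> `|B e| <= C * `|e|) ->
  forall e, E m e -> `|xs n s (fdd_comp E (B e) n)| <= D * C * `|e|.
Proof.
move=> BC e Ee.
apply: le_trans
  (functional_le hE hF hFbasis hxs hT hTD _ (fdd_comp_mem hE _ _)) _.
rewrite -mulrA; apply: ler_wpM2l; first exact: ltW.
by apply: le_trans (fdd_comp_le hE _ _) _; exact: BC.
Qed.

(** In the factor [1 + D], the 1 accounts for the vectors at which (a) applies and [D] for the few
    exceptional ones, where only the norm of [T] is used. *)
Definition small_on_contractions (j m : nat) (N : set nat) :=
  forall B : X -> X, bounded_op (E m) (fdd_sub E N) B ->
    (opnorm (E m) B <= 1%:E)%E ->
    \sum_(i < l m) `|T (B (x m i))| <= (1 + D) * (l m)%:R / j.+1%:R.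

Lemma small_on_contractions_exists (j : nat) (M : set nat) : infinite_set M ->
  exists (m : nat) (N : set nat),
    [/\ M m, infinite_set N, N `<=` M & small_on_contractions j m N].
Proof.
move=> Minf.
have j0 : 0 < j.+1%:R^-1 :> R by rewrite invr_gt0 ltr0Sn.
have [delta [N1 [d0 N1inf N1M aN1]]] := ha _ _ j0 Minf.
(* After multiplication by the norm bound [D] this ratio becomes [delta / 2], strictly below
   [delta]. *)
have dD : 0 < delta / (2 * D) by rewrite divr_gt0// mulr_gt0.
have [L L0 Lphi] := phi_ratio_small dD.
(* Each functional counted in (b) will spoil at most [L] vectors; this fraction then leaves at most
   [l m / (j+1)] spoiled vectors in all. *)
have e0 : 0 < (j.+1%:R * L%:R)^-1 :> R by rewrite invr_gt0 mulr_gt0// ltr0n.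
have [m [N2 [N1m N2inf N21 bN2]]] := hb _ _ _ d0 e0 N1inf.
exists m, N2; split => //; [exact: N1M|by move=> n /N21/N1M|].
move=> B Bb B1; have [/= Sfin Scard] := bN2 B Bb B1.
set S := [set p : {n : nat & 'I_(l n)} | _] in Sfin Scard.
have [BN lB _] := Bb.
have Bcontr e : E m e -> `|B e| <= 1 * `|e|.
  by apply: opnorm_bound => //; exact: fdd_subspace.
have Bx1 i : `|B (x m i)| <= 1.
  by have := Bcontr _ (hx m i).1; rewrite (hx m i).2 mulr1.
pose g (p : {n : nat & 'I_(l n)}) (z : X) : R^o :=
  xs (tag p) (tagged p) (fdd_comp E (B z) (tag p)).
pose big p : {set 'I_(l m)} := finset (fun i => delta < `|g p (x m i)|).
(* With more than [L] large values, their sum would be at least [delta] and at most [delta / 2]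
   times their number. *)
have card_big p : (#|big p| <= L)%N.
  have [//|Lbig] := leqP #|big p| L.
  have big0 : 0 < #|big p|%:R :> R by rewrite ltr0n (leq_ltn_trans _ Lbig).
  have h1 : \sum_(i in big p) delta <= \sum_(i in big p) `|g p (x m i)|.
    by apply: ler_sum => i; rewrite inE => /ltW.
  have h2 : \sum_(i in big p) `|g p (x m i)| <= D * phi x m #|big p|.
    apply: (sum_functional_le hE hx); first exact: ltW.
      exact: functional_comp_linear.
    move=> e Ee; rewrite -[D]mulr1.
    exact: (functional_comp_le (tagged p) Bcontr Ee).
  have h3 : phi x m #|big p| <= delta / (2 * D) * #|big p|%:R.
    apply: Lphi; first exact: ltnW.
    by rewrite -[leqRHS]card_ord max_card.
  have h4 : D * phi x m #|big p| <= delta / 2 * #|big p|%:R.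
    apply: le_trans (ler_wpM2l (ltW D0) h3) _.
    by rewrite le_eqVlt; apply/orP; left; apply/eqP; field; rewrite gt_eqF.
  rewrite sumr_const -mulr_natr in h1.
  have := le_trans h1 (le_trans h2 h4); rewrite ler_pM2r//; lra.
pose bad := \big[@finset.setU _/finset.set0]_(p <- fset_set S) big p.
have card_bad : (#|bad|%:R <= (l m)%:R / j.+1%:R :> R).
  have : (#|bad| <= #|` fset_set S| * L)%N by exact: card_big_setU_le.
  rewrite -(ler_nat R) => /le_trans; apply; rewrite natrM.
  apply: le_trans (ler_wpM2r _ (ltW Scard)) _; first exact: ler0n.
  rewrite invfM -!mulrA [L%:R^-1 * _]mulrCA mulVf ?pnatr_eq0 -?lt0n// mulr1.
  by rewrite mulrC.
(* Outside [bad] no functional on a block of [N1] exceeds [delta], so (a) applies to [B (x m i)]. *)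
have good i : i \notin bad -> `|T (B (x m i))| <= j.+1%:R^-1.
  move=> ibad.
  have zN1 : fdd_sub E N1 (B (x m i)).
    by apply: (fdd_sub_mono hE N21); apply: BN; exact: (hx m i).1.
  rewrite -(fdd_proj_id hE zN1); apply/ltW/aN1 => //.
  apply: ge_ereal_sup => _ [n [s [N1n ->]]]; rewrite lee_fin leNgt.
  apply: contra ibad => dlt.
  (* (a) tests all blocks of [N1], whereas (b) counts only those of [N2]. On the others the image of
     [B] has zero component. *)
  have N2n : N2 n.
    apply: contrapT => N2n; move: dlt.
    have /(fdd_subP hE)/(_ n N2n) -> := BN _ (hx m i).1.
    by rewrite (functional0 hE hxs) normr0 ltNge (ltW d0).
  have pS : Tagged (fun n => 'I_(l n)) s \in fset_set S.
    by rewrite in_fset_set// mem_set//; split => //; exists i.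
  by rewrite /bad (big_rem _ pS)/= inE; apply/orP; left; rewrite inE.
rewrite (bigID (mem bad))/= addrC.
have hgood : \sum_(i | i \notin bad) `|T (B (x m i))| <= (l m)%:R / j.+1%:R.
  apply: (@le_trans _ _ (\sum_(i | i \notin bad) j.+1%:R^-1)).
    by apply: ler_sum => i; exact: good.
  rewrite sumr_const -[leLHS]mulr_natl ler_pM2r// ler_nat.
  by rewrite -[leqRHS]card_ord max_card.
have hbad : \sum_(i in bad) `|T (B (x m i))| <= D * ((l m)%:R / j.+1%:R).
  apply: (@le_trans _ _ (\sum_(i in bad) D)).
    apply: ler_sum => i _; apply: le_trans (hTD _) _.
    by rewrite ler_piMr// ltW.
  by rewrite sumr_const -[leLHS]mulr_natr; apply: ler_wpM2l => //; exact: ltW.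
by rewrite -mulrA mulrDl mul1r; exact: lerD.
Qed.

(** This is (iii) at [k = l n], which is eventually large enough because [l] tends to infinity.
    Dividing by [c.+1] instead of [c] covers [c = 0]. *)
Lemma phi_tail (c : nat) (e : R) : 0 < e ->
  exists n0, forall n, (n0 <= n)%N -> c%:R * phi x n (l n) <= e * (l n)%:R.
Proof.
move=> e0.
have ec0 : 0 < e / c.+1%:R by rewrite divr_gt0// ltr0Sn.
have [L L0 Lphi] := phi_ratio_small ec0.
have /cvgnyPge/(_ L) [n0 _ n0L] := hl.
exists n0 => n n0n.
have := Lphi n (l n) (n0L _ n0n) (leqnn _) => h.
apply: (@le_trans _ _ (c.+1%:R * phi x n (l n))).
  by apply: ler_wpM2r; [exact: (phi_ge0 hx)|rewrite ler_nat].
rewrite (le_trans (ler_wpM2l _ h))//.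
by rewrite !mulrA [c.+1%:R * e]mulrC mulfK// pnatr_eq0.
Qed.

(* A state [(c, N)] records the total number [c] of coordinates used so far and
   the infinite set [N] from which later indices are to be taken. *)
Let step_spec (j : nat) (s : nat * set nat) (o : nat * set nat) :=
  infinite_set s.2 ->
  [/\ s.2 o.1, infinite_set o.2, o.2 `<=` s.2, small_on_contractions j o.1 o.2
    & forall n, o.2 n -> (o.1 < n)%N /\
        (s.1 + l o.1)%:R * phi x n (l n) <= j.+2%:R^-1 * (l n)%:R].

(** Once [m] is chosen, the total [s.1 + l m] is fixed, so cutting off an initial part of the later
    indices makes [phi_tail] available at all that remain. *)
Lemma subsequence_step j s : exists o, step_spec j s o.
Proof.
(* For finite [s.2] the specification is vacuous and any value will do; the step is thus total and
   [choice] applies to it. *)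
have [Ninf|Nfin] := pselect (infinite_set s.2); last by exists (0, setT).
have [m [N [Nm N1inf NM small]]] := small_on_contractions_exists j Ninf.
have j0 : 0 < j.+2%:R^-1 :> R by rewrite invr_gt0 ltr0Sn.
have [n0 hn0] := phi_tail (s.1 + l m) j0.
exists (m, N `&` [set n | (maxn n0 m.+1 <= n)%N]) => _; split => //=.
- exact: infinite_set_tail.
- by move=> n [/NM].
- move=> B [BN lB Bb] B1; apply: small => //; split => // e Ee.
  by apply: (fdd_sub_mono hE _ (BN e Ee)) => n [].
- by move=> n [_ /=]; rewrite geq_max => /andP[n0n mn]; split => //; exact: hn0.
Qed.

Lemma subsequence_exists : exists k : nat -> nat,
  [/\ {homo k : m n / (m < n)%N},
      forall j, exists2 N : set nat,
        small_on_contractions j (k j) N & forall i, (j < i)%N -> N (k i)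
    & forall j, (\sum_(i < j) l (k i))%:R * phi x (k j) (l (k j))
        <= j.+1%:R^-1 * (l (k j))%:R].
Proof.
have [g hg] := choice (fun p : nat * (nat * set nat) => subsequence_step p.1 p.2).
pose st := fix st j := if j is j'.+1 then
  let s := st j' in ((s.1 + l (g (j', s)).1)%N, (g (j', s)).2) else (0%N, setT).
pose k j := (g (j, st j)).1.
have stinf j : infinite_set (st j).2.
  elim: j => [|j IH]; first exact: infinite_nat.
  by have [] := hg (j, st j) IH.
have stsub i j : (i <= j)%N -> (st j).2 `<=` (st i).2.
  elim: j => [|j IH]; first by rewrite leqn0 => /eqP ->.
  rewrite leq_eqVlt => /predU1P[-> //|/IH]; apply: subset_trans.
  by have [] := hg (j, st j) (stinf j).
have kst j : (st j).2 (k j) by have [] := hg (j, st j) (stinf j).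
have ktail i j : (i < j)%N -> (st i.+1).2 (k j) by move=> /stsub; apply.
have stc j : (st j).1 = (\sum_(i < j) l (k i))%N.
  by elim: j => [|j IH]; [rewrite big_ord0|rewrite big_ord_recr/= -IH].
exists k; split.
- move=> i j /ktail; have [_ _ _ _ h] := hg (i, st i) (stinf i).
  by move=> /h[].
- move=> j; exists (st j.+1).2; last by move=> i; exact: ktail.
  by have [] := hg (j, st j) (stinf j).
(* At index 0 there are no earlier blocks. At [j.+1] the bound was secured in step [j], which is why
   [step_spec] carries [j.+2]. *)
- case=> [|j]; first by rewrite big_ord0 mul0r mulr_ge0.
  have [_ _ _ _ h] := hg (j, st j) (stinf j).
  by have [_] := h _ (ktail _ _ (ltnSn j)); rewrite -stc.
Qed.

(** Expresses the operator built from expansions along [E \o k] through [T] and a projection, both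
    defined on all of [X]. *)
Lemma diag_op_subseq (k : nat -> nat) (N : set nat) z :
  {homo k : m n / (m < n)%N} -> fdd_sub E (range k) z ->
  diag_op (fun n => E (k n)) (fun n => block_op xs f (k n)) N z =
  T (fdd_proj E (k @` N) z).
Proof.
move=> khomo zk.
have kinj := increasing_inj khomo.
rewrite /diag_op; apply: cvg_lim; first exact: norm_hausdorff.
set v := fdd_comp F (T (fdd_proj E (k @` N) z)).
have vE m : v m = if m \in k @` N then block_op xs f m (fdd_comp E z m) else 0.
  rewrite /v hT (fdd_proj_comp hE); case: ifP => // _.
  exact: (block_op0 hE f hxs).
have -> : series (fun n => if n \in N then
    block_op xs f (k n) (fdd_comp (fun n => E (k n)) z n) else 0) = series v \o k.
  apply/funext => m /=; rewrite /series/= (@big_subseq _ _ k v)//; last first.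
    move=> i ik; rewrite vE ifF//; apply/negP => /set_mem[a _ ai].
    by apply: ik; exists a.
  apply: eq_bigr => i _; rewrite vE (fdd_expansion_subseq hE khomo zk).
  congr (if _ then _ else _); apply/idP/idP => /set_mem.
    by move=> Ni; apply/mem_set; exists i.
  by move=> [a Na /kinj ai]; rewrite mem_set// -ai.
exact: (cvg_increasing_subseq khomo
  (fdd_cvg hF (x := T (fdd_proj E (k @` N) z)))).
Qed.

Lemma fdd_proj_finite (k : nat -> nat) (N : set nat) j z :
  injective k -> fdd_proj E (k @` (N `&` `I_j)) z =
  \sum_(a < j) if nat_of_ord a \in N then fdd_comp E z (k a) else 0.
Proof.
move=> kinj; apply: (fdd_ext hE) => n.
rewrite (fdd_proj_comp hE).
rewrite (linear_on_sum (@subspaceT _ _) (fdd_comp_linear hE n))//.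
case: ifPn => [/set_mem[a [Na aj] <-]|nN].
  rewrite (bigD1 (Ordinal aj))//= mem_set//.
  rewrite (fdd_comp_block hE _ (fdd_comp_mem hE _ _)) eqxx big1 ?addr0//.
  move=> b ba; case: ifP => _; last exact: fdd_comp0.
  rewrite (fdd_comp_block hE _ (fdd_comp_mem hE _ _)) ifF//; apply/negbTE.
  by apply: contra ba => /eqP/kinj ab; apply/eqP/val_inj.
rewrite big1// => a _; case: ifPn => aN; last exact: fdd_comp0.
rewrite (fdd_comp_block hE _ (fdd_comp_mem hE _ _)) ifF//; apply/negbTE.
apply: contra nN => /eqP ->; apply/mem_set; exists a => //.
by split; [exact: set_mem|exact: ltn_ord].
Qed.

(** The blocks of [N] are split at [j]. The earlier ones contribute [D * C] and the later ones
    [C * (1 + D)], which add up to [C * (1 + 2 * D)]. *)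
Lemma diag_op_average_le (k : nat -> nat) (j : nat) (N N' : set nat)
    (B : X -> X) (C : R) :
  {homo k : m n / (m < n)%N} ->
  small_on_contractions j (k j) N' -> (forall i, (j < i)%N -> N' (k i)) ->
  (\sum_(i < j) l (k i))%:R * phi x (k j) (l (k j))
     <= j.+1%:R^-1 * (l (k j))%:R ->
  ~ N j -> bounded_op (fdd_sub E (range k)) (fdd_sub E (range k)) B ->
  0 < C -> (forall z, fdd_sub E (range k) z -> `|B z| <= C * `|z|) ->
  \sum_(i < l (k j)) `|diag_op (fun n => E (k n))
      (fun n => block_op xs f (k n)) N (B (x (k j) i))|
    <= C * (1 + 2 * D) / j.+1%:R * (l (k j))%:R.
Proof.
move=> khomo small N'k lphi Nj Bb C0 BC.
have kinj := increasing_inj khomo.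
have [BK lB _] := Bb.
have EK e : E (k j) e -> fdd_sub E (range k) e.
  by apply: (fdd_sub_block hE); exists j.
have Ex i : E (k j) (x (k j) i) := (hx (k j) i).1.
pose lo := k @` (N `&` `I_j); pose hi := k @` (N `&` [set i | (j < i)%N]).
have split_proj z : fdd_proj E (k @` N) z = fdd_proj E lo z + fdd_proj E hi z.
  apply: (fdd_ext hE) => n.
  rewrite (linear_onD (fdd_comp_linear hE n))// !(fdd_proj_comp hE).
  have [nlo|nlo] := boolP (n \in lo).
    have [a [Na aj] an] := set_mem nlo.
    rewrite mem_set; last by exists a.
    rewrite memNset ?addr0// => -[b [Nb jb]]; rewrite -an => /kinj ba.
    by move: jb aj; rewrite /= ba ltnNge => /negP h /ltnW.
  rewrite add0r; congr (if _ then _ else _); apply/idP/idP => /set_mem.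
    move=> [a Na an]; apply/mem_set; exists a => //; split => //=.
    (* The block [k j] itself would belong to neither part; it is excluded by [~ N j]. *)
    case: (ltngtP j a) => // [aj|ja]; last by rewrite -ja in Na.
    by move/negP: nlo; case; apply/mem_set; exists a.
  by move=> [a [Na _] an]; apply/mem_set; exists a.
have hiN' : hi `<=` N' by move=> _ [i [_ ji] <-]; exact: N'k.
have upper : \sum_(i < l (k j)) `|T (fdd_proj E hi (B (x (k j) i)))|
    <= C * ((1 + D) * (l (k j))%:R / j.+1%:R).
  (* Division by [C] yields a contraction, and [hi] lies in [N'], so [small] applies to the upper
     part of [B]. *)
  have B2lin : linear_on (E (k j)) (fun z => C^-1 *: fdd_proj E hi (B z)).
    move=> a u v Eu Ev; rewrite lB ?(fdd_proj_linear hE)//; try exact: EK.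
    by rewrite scalerDr !scalerA [C^-1 * a]mulrC.
  have B2le e : E (k j) e -> `|C^-1 *: fdd_proj E hi (B e)| <= 1 * `|e|.
    move=> Ee; rewrite normrZ gtr0_norm ?invr_gt0// ler_pdivrMl// mul1r.
    by apply: le_trans (fdd_proj_le hE _ _) _; exact/BC/EK.
  have B2b : bounded_op (E (k j)) (fdd_sub E N')
      (fun z => C^-1 *: fdd_proj E hi (B z)).
    apply/bounded_opP; first exact: fdd_subspace.
    split => //; last by exists 1.
    move=> e Ee; apply: (fdd_sub_mono hE hiN').
    by apply: subspace_scale; [exact: fdd_sub_subspace|exact: fdd_proj_sub].
  have := small _ B2b (opnorm_le ler01 B2le).
  rewrite -(ler_pM2l C0) mulr_sumr => h; apply: le_trans h.
  apply: ler_sum => i _; rewrite (linear_onZ (@subspaceT _ _) hTlin)//.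
  by rewrite normrZ gtr0_norm ?invr_gt0// mulVKf ?gt_eqF.
have lower : \sum_(i < l (k j)) `|T (fdd_proj E lo (B (x (k j) i)))|
    <= D * C * ((\sum_(i < j) l (k i))%:R * phi x (k j) (l (k j))).
  (* On the finitely many earlier blocks the norm is at most the sum of the absolute coordinates.
     Each coordinate is a functional of norm at most [D * C], to be summed over all [x (k j) i]. *)
  have Tlo z : `|T (fdd_proj E lo z)| <=
      \sum_(a < j) \sum_(s < l (k a)) `|xs (k a) s (fdd_comp E z (k a))|.
    rewrite fdd_proj_finite// (linear_on_sum (@subspaceT _ _) hTlin)//.
    apply: le_trans (ler_norm_sum _ _ _) _; apply: ler_sum => a _.
    case: ifP => _; last first.
      by rewrite (linear_on0 (@subspaceT _ _) hTlin) normr0 sumr_ge0.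
    rewrite (diagonal_block hE hF hFbasis hxs hT (fdd_comp_mem hE _ _)).
    apply: le_trans (ler_norm_sum _ _ _) _; apply: ler_sum => s _.
    by rewrite normrZ; have [_ _ -> _] := hFbasis (k a); rewrite mulr1.
  apply: le_trans (ler_sum _ (fun i _ => Tlo (B (x (k j) i)))) _.
  rewrite exchange_big/= natr_sum mulr_suml mulr_sumr.
  apply: ler_sum => a _; rewrite exchange_big/=.
  apply: (@le_trans _ _ (\sum_(s < l (k a)) (D * C * phi x (k j) (l (k j))))).
    apply: ler_sum => s _.
    have := sum_functional_le hE hx [set: 'I_(l (k j))]%SET (K := D * C)
      (g := fun e => xs (k a) s (fdd_comp E (B e) (k a))).
    rewrite cardsT card_ord => h.
    rewrite (eq_bigl (fun i => i \in [set: 'I_(l (k j))]%SET)); last first.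
      by move=> i; rewrite inE.
    apply: h; first by rewrite mulr_ge0 ?ltW.
      apply: functional_comp_linear => b u v Eu Ev.
      by apply: lB; exact: EK.
    apply: functional_comp_le => e Ee; exact/BC/EK.
  by rewrite sumr_const card_ord -[leLHS]mulr_natl mulrCA.
have DC0 : 0 < D * C by rewrite mulr_gt0.
under eq_bigr => i _.
  rewrite diag_op_subseq//; last by apply: BK; exact: EK.
  rewrite split_proj (linear_onD hTlin)//.
  over.
apply: le_trans (ler_sum _ (fun i _ => ler_normD _ _)) _.
rewrite big_split/=; apply: le_trans (lerD lower upper) _.
have := ler_wpM2l (ltW DC0) lphi => h.
apply: le_trans (lerD h (lexx _)) _.
by rewrite le_eqVlt; apply/orP; left; apply/eqP; field.
Qed.

End Subsequence.

(** * Coding countable data by reals, and an almost disjoint family *)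

Section RealCodes.
Local Set Implicit Arguments.
Local Unset Strict Implicit.
Variable R : realType.

Let psum (S : set nat) n : R := \sum_(0 <= i < n) (i \in S)%:R * 3^-1 ^+ i.

(** Digits 0 and 1 in base 3 avoid the double expansions of base 2. *)
Definition ternary_code (S : set nat) : R := sup (range (psum S)).

Let psumS S n : psum S n.+1 = psum S n + (n \in S)%:R * 3^-1 ^+ n.
Proof. by rewrite /psum big_nat_recr. Qed.

Let pow_gt0 n : 0 < 3^-1 ^+ n :> R.
Proof. by rewrite exprn_gt0// invr_gt0. Qed.

Let psum_le S m n : (m <= n)%N -> psum S m <= psum S n.
Proof.
move=> /subnK <-; elim: (n - m)%N => // d; rewrite addSn psumS.
move=> /le_trans; apply.
by rewrite lerDl mulr_ge0// ltW.
Qed.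

Let psum_tail S m n : psum S m <= psum S n + 3 / 2 * 3^-1 ^+ n.
Proof.
have [mn|/ltnW /subnK <-] := leqP m n.
  by rewrite (le_trans (psum_le S mn))// lerDl mulr_ge0// ltW.
(* Keeping the remaining tail on the left makes the induction work: at each step it shrinks by the
   current power of [1 / 3], the most that the new digit can add. *)
suff : psum S (m - n + n) + 3 / 2 * 3^-1 ^+ (m - n + n)
    <= psum S n + 3 / 2 * 3^-1 ^+ n.
  by apply: le_trans; rewrite lerDl mulr_ge0// ltW.
elim: (m - n)%N => // d; rewrite addSn psumS => /(le_trans _); apply.
have := pow_gt0 (d + n); rewrite exprS; set t := _ ^+ _ => t0.
by case: (_ \in _) => /=; lra.
Qed.

Let code_ge S n : psum S n <= ternary_code S.
Proof.
apply: ub_le_sup; last by exists n.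
by exists (psum S 0 + 3 / 2 * 3^-1 ^+ 0) => _ [m _ <-].
Qed.

Let code_le S n : ternary_code S <= psum S n + 3 / 2 * 3^-1 ^+ n.
Proof.
by apply: ge_sup; [exists (psum S 0), 0|move=> _ [m _ <-]].
Qed.

(** At the first differing digit [n] one code gains [3^-1 ^+ n], while all later digits of the other
    amount to at most half of that. *)
Lemma ternary_code_inj : injective ternary_code.
Proof.
move=> S S'; apply: contraPP => /eqP SS'.
have ex : exists n, (n \in S) != (n \in S').
  apply: contrapT => /forallNP h; move/eqP: SS'; apply.
  have {}h n : (n \in S) = (n \in S') by apply/eqP/negPn/negP; exact: h.
  by apply/seteqP; split=> n /mem_set; [rewrite h|rewrite -h] => /set_mem.
case: (ex_minnP ex) => n nd nmin.
have eqp : psum S n = psum S' n.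
  rewrite /psum; apply: eq_big_nat => i /andP[_ ni].
  congr ((nat_of_bool _)%:R * _).
  by apply/eqP; apply: contraLR ni => /nmin; rewrite leqNgt.
have H (A B : set nat) : psum A n = psum B n -> n \in A -> n \notin B ->
    ternary_code B < ternary_code A.
  move=> AB nA nB.
  have := code_ge A n.+1; have := code_le B n.+1.
  rewrite !psumS AB nA (negbTE nB) exprS.
  by have := pow_gt0 n; set t := _ ^+ _ => t0 /=; lra.
case nS : (n \in S) nd; case nS' : (n \in S') => // _ /eqP.
  by rewrite gt_eqF// H// nS'.
by rewrite lt_eqF// H// nS.
Qed.

(** A family of reals is determined by its rational lower cuts, that is by a set of pairs [(i, q)];
    coded as a subset of [nat], this set has a ternary code. *)
Lemma countable_product_code (I : countType) :
  exists h : (I -> R) -> R, injective h.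
Proof.
pose cut (a : I -> R) : set nat :=
  @choice.pickle (I * rat)%type @` [set p | ratr p.2 < a p.1].
have cutinj a b : cut a = cut b -> forall i, b i <= a i.
  move=> ab i; rewrite leNgt; apply/negP => /rat_in_itvoo[q].
  rewrite in_itv/= => /andP[aq qb].
  have : cut b (choice.pickle (i, q)) by exists (i, q).
  rewrite -ab => -[[j r] /= ra /(pcan_inj choice.pickleK)[ji rq]].
  by move: ra; rewrite ji rq ltNge (ltW aq).
exists (ternary_code \o cut) => a b /ternary_code_inj ab.
by apply/funext => i; apply/eqP; rewrite eq_le !cutinj.
Qed.

(** The graph of the integer sequence [floor (n * r)], coded into [nat]; for distinct [r] these sets
    form the almost disjoint family. *)
Definition floor_graph (r : R) : set nat :=
  range (fun n : nat => choice.pickle (Num.floor (n%:R * r), n)).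

Lemma floor_graph_infinite r : infinite_set (floor_graph r).
Proof.
pose snd_code (c : nat) :=
  if choice.unpickle c is Some p then (p : int * nat).2 else 0%N.
move=> /(finite_image snd_code); apply: contra_not infinite_nat.
apply: sub_finite_set => n _; exists (choice.pickle (Num.floor (n%:R * r), n)).
  by exists n.
by rewrite /snd_code choice.pickleK.
Qed.

(** A common element has equal floors of [n * r] and [n * s], hence [n * |r - s| < 1], which only
    finitely many [n] satisfy. *)
Lemma floor_graph_almost_disjoint r s : r != s ->
  exists n0, forall n, (n0 <= n)%N -> floor_graph r n -> ~ floor_graph s n.
Proof.
move=> rs; pose code n : nat := choice.pickle (Num.floor (n%:R * r), n).
have rs0 : 0 < `|r - s| by rewrite normr_gt0 subr_eq0.
pose N := (Num.truncn `|r - s|^-1).+1.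
(* The threshold exceeds the codes of all [n < N], the only candidates for common elements. *)
exists (\max_(i < N) code i).+1 => _ /[swap] -[n _ <-] le [m _].
move=> /(pcan_inj choice.pickleK)[/esym nm mn]; move: nm; rewrite mn => nm.
have : n%:R * `|r - s| < 1.
  rewrite -{1}[n%:R]normr_nat -normrM mulrBr ltr_norml.
  have := floor_le (n%:R * r); have := floor_le (n%:R * s).
  have := floorD1_gt (n%:R * r); have := floorD1_gt (n%:R * s).
  rewrite nm !intrD; set t := (Num.floor _)%:~R => *.
  by apply/andP; split; lra.
rewrite -ltr_pdivlMr// div1r => nN.
have {nN} nN : (n < N)%N by rewrite ltnS truncn_ge_nat ?invr_ge0// ltW.
by move: le; rewrite ltnNge (@leq_bigmax _ (fun i : 'I_N => code i) (Ordinal nN)).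
Qed.

End RealCodes.

(** * Coding a bounded operator by one real number *)

Section OperatorCode.
Local Set Implicit Arguments.
Local Unset Strict Implicit.
Variable R : realType.

(** The spanning vectors may be dependent and [c] is an arbitrary choice of coefficients: all that
    matters is that the coefficients determine the component. *)
Lemma fdd_coordinates (X : normedModType R) (E : nat -> set X) : UFDD1 E ->
  exists (d : nat -> nat) (v : forall n, 'I_(d n) -> X)
         (c : X -> {n : nat & 'I_(d n)} -> R),
    forall z n, fdd_comp E z n = \sum_(i < d n) c z (Tagged _ i) *: v n i.
Proof.
move=> hE; have [[fin _ _] _] := hE.
have [d hd] := choice fin.
pose v n : 'I_(d n) -> X := xget (fun=> 0) [set v | E n = lin_span v].
have vE n : E n = lin_span (v n).
  have [w wE] := hd n; rewrite /v.
  by case: xgetP => [u _ //|/(_ w)[]].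
pose cn z n : 'I_(d n) -> R :=
  xget (fun=> 0) [set a | fdd_comp E z n = \sum_(i < d n) a i *: v n i].
exists d, v, (fun z p => cn z (tag p) (tagged p)) => z n /=.
have := fdd_comp_mem hE z n; rewrite vE => -[a ha].
by rewrite /cn; case: xgetP => [b _ //|/(_ a)[]].
Qed.

Lemma bounded_op_cvg (X Y : normedModType R) (U : X -> Y) (u : nat -> X) z :
  bounded_op setT setT U -> u n @[n --> \oo] --> z ->
  U (u n) @[n --> \oo] --> U z.
Proof.
move=> /bounded_opTP[lU [C C0 UC]] uz.
apply/cvgrPdist_le => e e0; near=> n.
rewrite -(linear_onB (@subspaceT _ _) lU)//; apply: le_trans (UC _) _.
rewrite mulrC -ler_pdivlMr//; near: n.
by move/cvgrPdist_le : uz; apply; exact: divr_gt0.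
Unshelve. all: by end_near. Qed.

(* A bounded operator is determined by the countably many coordinates of its
   values on a countable total set. *)
Lemma bounded_op_code (X Y : normedModType R) (E : nat -> set X)
    (F : nat -> set Y) : UFDD1 E -> UFDD1 F ->
  exists code : (X -> Y) -> R,
    {in bounded_op (@setT X) (@setT Y) &, injective code}.
Proof.
move=> hE hF.
have [d [v [c hc]]] := fdd_coordinates hE.
have [d' [v' [c' hc']]] := fdd_coordinates hF.
have [h hinj] := countable_product_code R
  ({n : nat & 'I_(d n)} * {n : nat & 'I_(d' n)})%type.
exists (fun U => h (fun p => c' (U (v (tag p.1) (tagged p.1))) p.2)).
move=> U V /set_mem Ub /set_mem Vb /hinj UV.
have [_ lU _] := Ub; have [_ lV _] := Vb.
have eqv n i : U (v n i) = V (v n i).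
  apply: (fdd_ext hF) => m; rewrite !hc'; apply: eq_bigr => j _.
  have := congr1 (@^~ (Tagged (fun n => 'I_(d n)) i,
                       Tagged (fun n => 'I_(d' n)) j)) UV.
  by move=> /= ->.
apply/funext => z.
(* The coefficients come from [z] alone, so [U] and [V] agree on the partial sums, and by continuity
   at [z]. *)
have sE W : linear_on setT W -> forall n, W (series (fdd_comp E z) n) =
    \sum_(0 <= k < n) \sum_(i < d k) c z (Tagged _ i) *: (W (v k i) : Y).
  move=> lW n; rewrite /series/= (linear_on_sum (@subspaceT _ _) lW)//.
  apply: eq_bigr => k _; rewrite hc (linear_on_sum (@subspaceT _ _) lW)//.
  by apply: eq_bigr => i _; rewrite (linear_onZ (@subspaceT _ _) lW).
apply: (cvg_unique _ (bounded_op_cvg Ub (fdd_cvg hE (x := z)))).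
  exact: norm_hausdorff.
have -> : (fun n => U (series (fdd_comp E z) n)) =
          (fun n => V (series (fdd_comp E z) n)).
  apply/funext => n; rewrite !sE//; apply: eq_bigr => k _.
  by apply: eq_bigr => i _; rewrite eqv.
exact: (bounded_op_cvg Vb (fdd_cvg hE (x := z))).
Qed.

End OperatorCode.

(** * Closed ideals defined by null averages, and their number *)

Section Ideals.
Variables (R : realType) (X Y : normedModType R).
Variables (l : nat -> nat) (x : forall n, 'I_(l n) -> X).
Hypothesis hx : forall n j, `|x n j| = 1.

Local Set Implicit Arguments.
Local Unset Strict Implicit.

(** The average is multiplied out by [l m], so that blocks with [l m = 0] need no special
    treatment. *)
Definition null_average (M : set nat) (U : X -> Y) :=
  forall e : R, 0 < e -> exists m0, forall m, (m0 <= m)%N -> M m ->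
    \sum_(i < l m) `|U (x m i)| <= e * (l m)%:R.

Lemma null_average_cvg (M : set nat) (U : X -> Y) : null_average M U ->
  (\sum_(i < l m) `|U (x m i)|) / (l m)%:R @[m --> within M \oo] --> (0 : R).
Proof.
move=> U0; apply/cvgrPdist_le => e e0; have [m0 h] := U0 e e0.
rewrite near_withinE.
exists m0 => //= m m0m Mm; rewrite sub0r normrN ger0_norm; last first.
  by rewrite divr_ge0// sumr_ge0.
have [l0|l0] := posnP (l m); last by rewrite ler_pdivrMr ?ltr0n//; exact: h.
have -> : (l m)%:R = 0 :> R by rewrite l0.
by rewrite invr0 mulr0 ltW.
Qed.

Lemma bounded_op_comp (Z1 Z2 Z3 : normedModType R) (A : Z2 -> Z3) (B : Z1 -> Z2) :
  bounded_op setT setT A -> bounded_op setT setT B ->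
  bounded_op setT setT (A \o B).
Proof.
move=> /bounded_opTP[lA [C C0 AC]].
move=> /bounded_opTP[lB [C' C'0 BC]].
apply/bounded_opTP; split; first by move=> a u v _ _ /=; rewrite lB// lA.
exists (C * C'); first exact: mulr_gt0.
move=> z /=; apply: le_trans (AC _) _; rewrite -mulrA.
by apply: ler_wpM2l; [exact: ltW|exact: BC].
Qed.

Lemma null_average_linear (M : set nat) (a : R) (U V : X -> Y) :
  null_average M U -> null_average M V ->
  null_average M (fun z => a *: U z + V z).
Proof.
move=> U0 V0 e e0.
(* The added 1 permits division also when [a = 0]. *)
have a0 : 0 < `|a| + 1 by rewrite ltr_wpDl.
have [|m1 h1] := U0 (e / 2 / (`|a| + 1)); first by rewrite !divr_gt0.
have [|m2 h2] := V0 (e / 2); first by rewrite divr_gt0.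
exists (maxn m1 m2) => m; rewrite geq_max => /andP[m1m m2m] Mm.
apply: (@le_trans _ _
    (\sum_(i < l m) ((`|a| + 1) * `|U (x m i)| + `|V (x m i)|))).
  apply: ler_sum => i _; apply: le_trans (ler_normD _ _) _; rewrite normrZ.
  by rewrite lerD2r; apply: ler_wpM2r => //; rewrite lerDl.
rewrite big_split/= -mulr_sumr.
have := ler_wpM2l (ltW a0) (h1 m m1m Mm).
have -> : (`|a| + 1) * (e / 2 / (`|a| + 1) * (l m)%:R) = e / 2 * (l m)%:R.
  by field; rewrite gt_eqF.
by have := h2 m m2m Mm; lra.
Qed.

Definition null_ideal (S : set R) : set (X -> Y) :=
  [set U | bounded_op setT setT U /\ forall r, ~ S r ->
     forall B, bounded_op (@setT X) (@setT X) B ->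
       null_average (floor_graph r) (U \o B)].

(** Right factors are absorbed by the quantifier over [B] and left factors by their norm; norm
    limits are harmless because the [x m i] are normalized. *)
Lemma null_ideal_closed (S : set R) : closed_ideal (null_ideal S).
Proof.
split.
- by move=> U [].
- split; first by apply/bounded_opTP; split => // [a u v _ _|];
    [rewrite scaler0 addr0|exists 1 => // z; rewrite normr0 mul1r].
  move=> r _ B _ e e0; exists 0%N => m _ _.
  by rewrite big1 ?mulr_ge0 ?(ltW e0)// => i _; rewrite /= normr0.
- move=> a U V [Ub U0] [Vb V0]; split; last first.
    by move=> r nr B Bb; apply: null_average_linear; [exact: U0|exact: V0].
  move/bounded_opTP : Ub => [lU [C C0 UC]].
  move/bounded_opTP : Vb => [lV [C' C'0 VC]].
  apply/bounded_opTP; split => //.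
    move=> b u v _ _; rewrite lU// lV// !scalerDr !scalerA [b * a]mulrC.
    by rewrite addrACA.
  exists (`|a| * C + C'); first by rewrite ltr_wpDl// mulr_ge0// ltW.
  move=> z; apply: le_trans (ler_normD _ _) _; rewrite normrZ mulrDl -mulrA.
  by apply: lerD; [apply: ler_wpM2l => //; exact: UC|exact: VC].
- move=> A U B Ab [Ub U0] Bb; split.
    by apply: bounded_op_comp => //; exact: bounded_op_comp.
  move=> r nr B' B'b e e0.
  move/bounded_opTP : (Ab) => [_ [C C0 AC]].
  have [|m0 h] := U0 r nr (B \o B') (bounded_op_comp Bb B'b) (e / C).
    by rewrite divr_gt0.
  exists m0 => m m0m Mm; have := ler_wpM2l (ltW C0) (h m m0m Mm).
  have -> : C * (e / C * (l m)%:R) = e * (l m)%:R by field; rewrite gt_eqF.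
  rewrite mulr_sumr; apply: le_trans.
  by apply: ler_sum => i _; exact: AC.
- move=> U Ub Uapp; split => // r nr B Bb e e0.
  move/bounded_opTP : (Bb) => [_ [C C0 BC]].
  (* As [B (x m i)] has norm at most [C], the values of [U] and [V] there differ by at most
     [e / 2]. *)
  have [|V [Vb V0] UV] := Uapp (e / (2 * C)).
    by rewrite divr_gt0// mulr_gt0.
  have UVle z : `|U z - V z| <= e / (2 * C) * `|z|.
    have [_ lU _] := Ub; have [_ lV _] := Vb.
    apply: (opnorm_bound (@subspaceT _ _) _ (ltW UV)) => //.
    move=> a u v _ _; rewrite lU// lV// scalerBr opprD addrACA.
    by [].
  have [|m0 h] := V0 r nr B Bb (e / 2); first by rewrite divr_gt0.
  exists m0 => m m0m Mm.
  apply: (@le_trans _ _ (\sum_(i < l m) (e / 2 + `|V (B (x m i))|))).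
    apply: ler_sum => i _ /=.
    rewrite -[U _](subrK (V (B (x m i)))); apply: le_trans (ler_normD _ _) _.
    rewrite lerD2r; apply: le_trans (UVle _) _.
    have -> : e / 2 = e / (2 * C) * C by field; rewrite gt_eqF.
    apply: ler_wpM2l; first by rewrite ltW// divr_gt0// mulr_gt0.
    by have := BC (x m i); rewrite hx mulr1.
  rewrite big_split/= sumr_const card_ord -mulr_natr.
  by have := h m m0m Mm; rewrite /=; lra.
Qed.

(** The operators [S (floor_graph r)] tell the ideals apart, so [null_ideal] is injective on sets of
    reals. *)
Lemma card_closed_ideals_ge (S : set nat -> X -> Y) :
  (forall N, bounded_op setT setT (S N)) ->
  (forall N n j, N n -> 1 <= `|S N (x n j)|) ->
  (forall M N B, infinite_set M -> infinite_set N -> infinite_set (M `\` N) ->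
     bounded_op (@setT X) (@setT X) B -> null_average (M `\` N) (S N \o B)) ->
  (exists m0, forall m, (m0 <= m)%N -> (0 < l m)%N) ->
  ([set: set R] #<= [set J : set (X -> Y) | closed_ideal J])%card.
Proof.
move=> Sb S1 S0 [ml lpos].
have mem A r : null_ideal A (S (floor_graph r)) <-> A r.
  split=> [[_ h]|Ar]; last first.
    split => // s As B Bb.
    have rs : s != r by apply: contra_not_neq As => ->.
    have [n0 ad] := floor_graph_almost_disjoint rs.
    (* Beyond [n0] the set of [s] lies in the difference, so null averages along the difference are
       null averages along the whole set. *)
    have inf : infinite_set (floor_graph s `\` floor_graph r).
      apply: sub_infinite_set
        (infinite_set_tail _ n0 (@floor_graph_infinite _ s)).
      by move=> n [sn n0n]; split => //; exact: ad.
    have Sav := S0 _ _ B (@floor_graph_infinite _ s)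
      (@floor_graph_infinite _ r) inf Bb.
    move=> e /Sav[m0 hm0]; exists (maxn m0 n0) => m; rewrite geq_max.
    by move=> /andP[m0m n0m] sm; apply: hm0 => //; split => //; exact: ad.
  apply: contrapT => Ar.
  have idb : bounded_op (@setT X) (@setT X) id.
    by apply/bounded_opTP; split => //; exists 1 => // z; rewrite mul1r.
  (* With the identity for [B], all terms along [floor_graph r] are at least 1, so an average of at
     most [1 / 2] is absurd once [l m] is positive. *)
  have [//|m0 hm0] := h r Ar id idb (1 / 2).
  have := @floor_graph_infinite _ r.
  move=> /(infinite_set_tail _ (maxn m0 ml))/infinite_setN0[m [rm]].
  rewrite /= geq_max => /andP[m0m mlm].
  have := hm0 m m0m rm; apply/negP; rewrite -ltNge.
  have lm : 0 < (l m)%:R :> R by rewrite ltr0n lpos.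
  apply: (@lt_le_trans _ _ (l m)%:R); first by lra.
  apply: (@le_trans _ _ (\sum_(i < l m) 1)); first by rewrite sumr_const card_ord.
  by apply: ler_sum => i _; exact: S1.
have /card_eqPle[_ le] : (null_ideal @` [set: set R] #= [set: set R])%card.
  apply: inj_card_eq => A A' _ _ AA'; apply/seteqP.
  by split=> r /mem; [rewrite AA' => /mem|rewrite -AA' => /mem].
apply: card_le_trans le (subset_card_le _) => _ [A _ <-].
exact: null_ideal_closed.
Qed.

End Ideals.

(** An ideal is recovered from the set of codes of its members. The code is injective only on
    bounded operators, which is all that an ideal contains. *)
Lemma card_closed_ideals_le (R : realType) (X Y : normedModType R)
    (E : nat -> set X) (F : nat -> set Y) : UFDD1 E -> UFDD1 F ->
  ([set J : set (X -> Y) | closed_ideal J] #<= [set: set R])%card.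
Proof.
move=> hE hF; have [code codeinj] := bounded_op_code hE hF.
apply/pcard_injP; exists (fun J => code @` J) => J J' /set_mem[Jb _ _ _ _].
move=> /set_mem[J'b _ _ _ _] JJ'.
have H (I I' : set (X -> Y)) : I `<=` bounded_op setT setT ->
    I' `<=` bounded_op setT setT -> code @` I = code @` I' -> I `<=` I'.
  move=> Ib I'b II' U IU; have : (code @` I) (code U) by exists U.
  rewrite II' => -[V I'V /codeinj]; rewrite !inE => <- //.
    exact: I'b.
  exact: Ib.
by apply/seteqP; split; apply: H.
Qed.

(** * The properties of the subsequence and the number of closed ideals *)

Theorem proposition2 (R : realType) (X Y : completeNormedModType R)
  (E : nat -> set X) (F : nat -> set Y) (hE : UFDD1 E) (hF : UFDD1 F)
  (hEbasis : forall n, exists (d : nat) (e : 'I_d -> X),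
     normalized_1unconditional_basis (E n) e)
  (l : nat -> nat) (f : forall n, 'I_(l n) -> Y)
  (hFbasis : forall n, normalized_1unconditional_basis (F n) (@f n))
  (x : forall n, 'I_(l n) -> X)
  (hx : forall n j, E n (@x n j) /\ `|@x n j| = 1)
  (xs : forall n, 'I_(l n) -> X -> R^o)
  (hxs : forall n j, bounded_op (E n) setT (@xs n j))
  (* (i) *)
  (T : X -> Y)
  (hT : forall z n, fdd_comp F (T z) n = block_op xs f n (fdd_comp E z n))
  (hTb : bounded_op setT setT T)
  (* (ii) *)
  (hii : forall n j, 1 <= @xs n j (@x n j))
  (* (iii) *)
  (hl : l m @[m --> \oo] --> \oo)
  (hphi : sup [set phi x m k / k%:R | m in [set m | (k <= l m)%N]]
            @[k --> \oo] --> (0 : R))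
  (ha : forall (eps : R) (M : set nat), 0 < eps -> infinite_set M ->
     exists (delta : R) (N : set nat),
       [/\ 0 < delta, infinite_set N, N `<=` M
         & forall z, fdd_sub E N z -> `|z| <= 1 ->
           (ereal_sup [set r | exists (n : nat) (j : 'I_(l n)),
                         N n /\ r = (`|@xs n j (fdd_comp E z n)|)%:E]
              <= delta%:E)%E ->
           `|T (fdd_proj E N z)| < eps])
  (hb : forall (delta eps : R) (M : set nat),
     0 < delta -> 0 < eps -> infinite_set M ->
     exists (m : nat) (N : set nat),
       [/\ M m, infinite_set N, N `<=` M
         & forall B : X -> X,
           bounded_op (E m) (fdd_sub E N) B -> (opnorm (E m) B <= 1%:E)%E ->
           let S := [set p : {n : nat & 'I_(l n)} | N (tag p) /\
             exists i : 'I_(l m),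
               delta < `|@xs (tag p) (tagged p) (fdd_comp E (B (@x m i)) (tag p))| ]
           in
           finite_set S /\ (#|` fset_set S|)%:R < eps * (l m)%:R]) :
  (exists k : nat -> nat,
     let Xt := fdd_sub E (range k) in
     let Et := fun n => E (k n) in
     let Ft := fun n => F (k n) in
     let Tt := fun n => block_op xs f (k n) in
     let lt := fun n => l (k n) in
     let xt := fun n (j : 'I_(lt n)) => @x (k n) j in
     let yt := fun n (j : 'I_(lt n)) => coord_functional (@f (k n)) j in
     [/\ {homo k : m n / (m < n)%N},
         forall n j, [/\ 1 <= yt n j (Tt n (xt n j)), `|xt n j| = 1
                       & opnorm (Ft n) (yt n j) = 1%:E]
       & forall M N : set nat, infinite_set M -> infinite_set N ->
           infinite_set (M `\` N) ->
           forall B : X -> X, bounded_op Xt Xt B ->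
           (\sum_(i < lt m) `|diag_op Et Tt N (B (xt m i))|) / (lt m)%:R
             @[m --> within (M `\` N) \oo] --> (0 : R)])
  /\ ([set J : set (X -> Y) | closed_ideal J] #= [set: set R])%card.
Proof.
have /bounded_opTP[Tlin [D D0 TD]] := hTb.
have [k [khomo kgood kphi]] :=
  subsequence_exists hE hF hFbasis hx hxs hT hl hphi ha hb D0 TD.
pose lt n := l (k n).
pose xt n (j : 'I_(lt n)) := x (k n) j.
pose diag N := diag_op (fun n => E (k n)) (fun n => block_op xs f (k n)) N.
have null (M N : set nat) (B : X -> X) :
    bounded_op (fdd_sub E (range k)) (fdd_sub E (range k)) B ->
    null_average xt (M `\` N) (diag N \o B).
  move=> Bb e e0.
  have [_ _ [C C0 BC]] :=
    (bounded_opP _ _ (fdd_sub_subspace hE (range k))).1 Bb.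
  have c0 : 0 < C * (1 + 2 * D) by rewrite mulr_gt0//; lra.
  (* From this index on, [C * (1 + 2 * D) / (m + 1)] is at most [e]. *)
  exists (Num.truncn (C * (1 + 2 * D) / e)) => m m0 [_ Nm].
  have [N' small N'k] := kgood m.
  apply: le_trans (diag_op_average_le hE hF hFbasis hx hxs hT Tlin D0 TD
    khomo small N'k (kphi m) Nm Bb C0 BC) _.
  apply: ler_wpM2r => //; rewrite ler_pdivrMr// -ler_pdivrMl// mulrC.
  by rewrite ltW// -truncn_le_nat.
split.
  exists k; split => //.
    move=> n j; split; last exact: coord_functional_opnorm.
      by rewrite (coord_block_op hFbasis); exact: hii.
    exact: (hx _ _).2.
  by move=> M N _ _ _ B Bb; exact: (null_average_cvg (null M N B Bb)).
have projb N : bounded_op setT setT (fdd_proj E N).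
  apply/bounded_opTP; split; first exact: fdd_proj_linear.
  by exists 1 => // z; rewrite mul1r; exact: fdd_proj_le.
apply/card_eqPle; split; first exact: card_closed_ideals_le hE hF.
(* The witnesses must act on all of [X]: [T] after the projection to the blocks [k n] with [n] in
   [N] extends the diagonal operator. *)
apply: (@card_closed_ideals_ge _ _ _ lt xt _
  (fun N => T \o fdd_proj E (k @` N))).
- by move=> n j; exact: (hx _ _).2.
- by move=> N; exact: bounded_op_comp.
- move=> N n j Nn; have [Ex _] := hx (k n) j.
  rewrite /= (fdd_proj_id hE); last first.
    by apply: (fdd_sub_block hE _ Ex); exists n.
  rewrite (diagonal_block hE hF hFbasis hxs hT Ex).
  apply: le_trans (basis_coord_le (hFbasis (k n)) (fun s => xs (k n) s _) j).
  by apply: le_trans (hii _ _) (ler_norm _).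
- move=> M N B _ _ _ Bb.
  (* [null] concerns operators on the subspace of [range k], so [B] is first compressed to it. The
     witness sees only blocks in [range k], hence its values are unchanged. *)
  have B'b : bounded_op (fdd_sub E (range k)) (fdd_sub E (range k))
      (fdd_proj E (range k) \o B).
    have [_ lin bd] := bounded_op_comp (projb (range k)) Bb.
    split; first by move=> z _; exact: fdd_proj_sub.
      by move=> a u v _ _; exact: lin.
    apply: le_lt_trans bd; apply: ereal_sup_le => _ [z [_ z1] <-].
    by exists z.
  move=> e e0; have [m0 h] := null M N _ B'b e e0.
  exists m0 => m m0m Mm; apply: le_trans (h m m0m Mm).
  apply: ler_sum => i _; rewrite /= /diag.
  rewrite (diag_op_subseq hE hF hxs hT)//; last first.
    exact: fdd_proj_sub.
  rewrite le_eqVlt; apply/orP; left; apply/eqP; congr (`|T _|).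
  apply: (fdd_ext hE) => n; rewrite !(fdd_proj_comp hE).
  case: ifP => // /set_mem[a _ an].
  by rewrite mem_set//; exists a.
(* Since [k m >= m], the growth of [l] passes to the subsequence, and [lt m] is eventually
   positive. *)
- have /cvgnyPge/(_ 1%N) [n0 _ n0L] := hl.
  exists n0 => m n0m; apply: n0L => /=; apply: leq_trans n0m _.
  by elim: m => // m /leq_ltn_trans; apply; exact: khomo.
Qed.
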